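(* Let $H$ be a Hilbert space over $\mathbf K\in\{\mathbb R,\mathbb C\}$ and let $\mathcal S$ be the normed algebra of all finite rank bounded operators on $H$. The normal category $\mathscr L(\mathcal S)$ of principal left ideals of $\mathcal S$ is isomorphic, as a normal category, to the normal category $\mathscr F(H)$ of finite-dimensional subspaces of $H$, via an isomorphism sending $\mathcal SP_M$ to $M$; and for all finite-dimensional subspaces $M$ and $N$ of $H$ this isomorphism restricts to a normed space isomorphism (linear, bijective, norm-preserving) from the hom-set $\mathscr L(\mathcal S)(\mathcal SP_M,\mathcal SP_N)$ onto the hom-set $\mathscr F(H)(M,N)$.
   Context: Composition convention: operators and morphisms are composed left to right, i.e. $(T_1T_2)(x)=T_2(T_1(x))$, and $fg$ means first $f$, then $g$. $\mathcal S$ carries the operator norm. For a finite-dimensional subspace $M$ of $H$, $P_M$ is the orthogonal projection of $H$ onto $M$. Category $\mathscr L(\mathcal S)$: objects are the principal left ideals $\mathcal SP=\{AP: A\in\mathcal S\}$ with $P\in\mathcal S$ idempotent; every object equals $\mathcal SP_M$ for a unique finite-dimensional subspace $M$ of $H$ (namely $M=R(P)$, the range of $P$). Morphisms $\mathcal SP_1\to\mathcal SP_2$ are the maps $\rho(P_1,T,P_2): A\mapsto AT$ for $T\in P_1\mathcal SP_2$; composition is composition of maps. Inclusions are the set inclusions. The hom-set $\mathscr L(\mathcal S)(\mathcal SP_M,\mathcal SP_N)$ is a normed space with $\rho(P_M,T_1,P_N)+\rho(P_M,T_2,P_N)=\rho(P_M,T_1+T_2,P_N)$, $k\rho(P_M,T,P_N)=\rho(P_M,kT,P_N)$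 and $\|\rho(P_M,T,P_N)\|=\|T\|$. Category $\mathscr F(H)$: objects are the finite-dimensional subspaces of $H$; morphisms $M\to N$ are all linear maps; inclusions are subspace inclusions; each hom-set is a normed space under the operator norm. A category with subobjects is a small category $\mathscr C$ with a subcategory $\mathscr P$ having the same objects, such that $\mathscr P$ is a strict preorder (at most one morphism between any two objects, and the relation ''there is a morphism $p\to p'$'' is a partial order), every morphism of $\mathscr P$ (called an inclusion) is a monomorphism in $\mathscr C$, and if $f=hg$ with $f,g\in\mathscr P$, $h\in\mathscr C$, then $h\in\mathscr P$. A retraction is a morphism $q$ with $jq=1$ for some inclusion $j$. A normal factorization of $f$ is $f=quj$ with $q$ a retraction, $u$ an isomorphism, $j$ an inclusion. A cone $\gamma$ with vertex $d$ assigns to each object $c$ a morphism $\gamma(c):c\to d$ with $j\gamma(c)=\gamma(c')$ for every inclusion $j:c'\to c$; it is normal if some $\gamma(c)$ is an isomorphism. A normal category is a category with subobjects in which every morphism has a normal factorization, every inclusion splits (has a retraction), and for each object $d$ there is a normal cone $\gamma$ with vertex $d$ and $\gamma(d)=1_d$. Two normal categories are isomorphic if there are mutually inverse inclusion-preserving functors between them. *)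

(* Defs.v *)
From HB Require Import structures.
From mathcomp Require Import all_boot all_order all_algebra.
From mathcomp Require Import sesquilinear complex.
From mathcomp Require Import boolp classical_sets functions reals.
From mathcomp Require Import topology normedtype.

Set Implicit Arguments.
Unset Strict Implicit.
Unset Printing Implicit Defensive.
Import Order.TTheory GRing.Theory Num.Theory.
Import numFieldNormedType.Exports.
Local Open Scope classical_set_scope.
Local Open Scope ring_scope.

Inductive scalar_kind := RealScalars | ComplexScalars.

Definition scalar_field (R : realType) (k : scalar_kind) : numFieldType :=
  match k with
  | RealScalars => R : numFieldType
  | ComplexScalars => R[i] : numFieldType
  end.

Definition scalar_conj (R : realType) (k : scalar_kind) :
    scalar_field R k -> scalar_field R k :=
  match k return scalar_field R k -> scalar_field R k with
  | RealScalars => fun x => x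
  | ComplexScalars => fun z => conjc z
  end.

Definition scalar_re (R : realType) (k : scalar_kind) : scalar_field R k -> R :=
  match k return scalar_field R k -> R with
  | RealScalars => fun x => x
  | ComplexScalars => fun z => complex.Re z
  end.

(* The inner product is linear in its first argument. *)
Record hilbertType (R : realType) (k : scalar_kind) := HilbertType {
  hilbert_sort :> completeNormedModType (scalar_field R k);
  inner : {dot hilbert_sort for @scalar_conj R k};
  inner_norm : forall x : hilbert_sort, `|x| ^+ 2 = inner x x
}.

(* The norm of a normed module over K takes its values in K. *)
Definition hnorm (R : realType) (k : scalar_kind) (H : hilbertType R k)
  (x : H) : R := scalar_re `|x|.

Section Subspaces.
Variables (K : fieldType) (V : lmodType K).

Definition lspan (n : nat) (v : 'I_n -> V) : set V :=
  [set x | exists a : 'I_n -> K, x = \sum_(i < n) a i *: v i].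

Definition fin_dim (M : set V) := exists n (v : 'I_n -> V), M = lspan v.

Definition is_subspace (M : set V) :=
  M 0 /\ forall a x y, M x -> M y -> M (a *: x + y).

Record subspace := Subspace {
  subspace_set :> set V;
  subspaceP : is_subspace subspace_set
}.

Lemma subspace_inj (M N : subspace) : M = N :> set V -> M = N.
Proof.
case: M N => [M Mp] [N Np] /= MN; subst N.
by rewrite (Prop_irrelevance Mp Np).
Qed.

Definition subspace_pred (M : subspace) : {pred V} := fun x => x \in (M : set V).

Lemma subspace_pred_closed M : submod_closed (subspace_pred M).
Proof.
case: M => M [M0 Ml]; split; first by rewrite /subspace_pred !inE.
by move=> a x y; rewrite /subspace_pred !inE; exact: Ml.
Qed.

HB.instance Definition _ M :=
  GRing.isSubmodClosed.Build K V (subspace_pred M) (subspace_pred_closed M).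

Record elt (M : subspace) := Elt {
  elt_val :> V;
  elt_valP : elt_val \in subspace_pred M
}.

HB.instance Definition _ M := [isSub of elt M for @elt_val M].
HB.instance Definition _ M := [Choice of elt M by <:].
HB.instance Definition _ M := [SubChoice_isSubLmodule of elt M by <:].

Lemma elt_in (M : subspace) (x : elt M) : subspace_set M x.
Proof. by have := elt_valP x; rewrite /in_mem /= /subspace_pred inE. Qed.

Definition to_elt (M : subspace) (x : V) (Mx : subspace_set M x) : elt M :=
  Elt (mem_set Mx : x \in subspace_pred M).

Lemma elt_inj (M : subspace) (x y : elt M) : x = y :> V -> x = y.
Proof. exact: val_inj. Qed.

Lemma span_subspace n (v : 'I_n -> V) : is_subspace (lspan v).
Proof.
split; first by exists (fun=> 0); rewrite big1 // => i _; rewrite scale0r.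
move=> a _ _ [b ->] [c ->]; exists (fun i => a * b i + c i).
rewrite scaler_sumr -big_split; apply: eq_bigr => i _ /=.
by rewrite scalerDl scalerA.
Qed.

Definition fcons n (x : V) (v : 'I_n -> V) (i : 'I_n.+1) : V :=
  oapp v x (unlift ord0 i).

Lemma span_fcons n x (v : 'I_n -> V) y :
  lspan (fcons x v) y <-> exists c s, lspan v s /\ y = c *: x + s.
Proof.
split=> [[a ->]|[c [_ [[a ->] ->]]]].
  rewrite big_ord_recl /fcons unlift_none /=.
  exists (a ord0), (\sum_(i < n) a (lift ord0 i) *: v i).
  split; first by exists (fun i => a (lift ord0 i)).
  by congr (_ + _); apply: eq_bigr => i _; rewrite liftK.
exists (fun i => oapp a c (unlift ord0 i)).
rewrite big_ord_recl /fcons unlift_none /=; congr (_ + _).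
by apply: eq_bigr => i _; rewrite liftK.
Qed.

Lemma fcons_lift n (v : 'I_n.+1 -> V) :
  v = fcons (v ord0) (fun i => v (lift ord0 i)).
Proof.
by apply/funext => i; rewrite /fcons; case: unliftP => [j|] ->.
Qed.

Lemma fin_dim_sub (M : set V) n (v : 'I_n -> V) :
  is_subspace M -> M `<=` lspan v -> fin_dim M.
Proof.
elim: n v M => [|n IHn] v M Msub Mv.
  exists 0, v; apply/seteqP; split=> // x [a ->].
  by rewrite big_ord0; case: Msub.
rewrite (fcons_lift v) in Mv; move: (v ord0) (fun i => _) Mv => {v} u v Mv.
have [M0 Ml] := Msub; have [S0 Sl] := span_subspace v.
have /IHn : is_subspace (M `&` lspan v).
  by split=> [//|a x y [? ?] [? ?]]; split; [exact: Ml|exact: Sl].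
move=> /(_ v (@subIsetr _ _ _)) [m [w Mw]].
have wM x : lspan w x -> M x by rewrite -Mw => -[].
have [sMv|] := pselect (M `<=` lspan v); first exact: IHn sMv.
move=> /existsNP [x /not_implyP [Mx Nx]].
exists m.+1, (fcons x w); apply/seteqP; split=> y; last first.
  by move=> /span_fcons [c [s [/wM Ms ->]]]; exact: Ml.
move=> My; apply/span_fcons.
have /span_fcons [c [s [vs xE]]] := Mv _ Mx.
have /span_fcons [d [t [vt yE]]] := Mv _ My.
have c0 : c != 0.
  by apply/eqP => c0; apply: Nx; rewrite xE c0 scale0r add0r.
exists (d / c), (y - (d / c) *: x); split; last by rewrite addrC subrK.
rewrite -Mw; split.
  by rewrite addrC -scaleNr; exact: Ml.
rewrite yE xE scalerDr scalerA divfK // opprD addrACA subrr add0r addrC.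
by rewrite -scaleNr; exact: Sl.
Qed.

Lemma fin_dim_add (M N : set V) :
  fin_dim M -> fin_dim N -> fin_dim [set z | exists x y, [/\ M x, N y & z = x + y]].
Proof.
move=> [m [v ->]] [n [w ->]].
exists (m + n)%N, (fun i => match fintype.split i with inl j => v j | inr j => w j end).
apply/seteqP; split=> z.
  move=> [_ [_ [[a ->] [b ->] ->]]].
  exists (fun i => match fintype.split i with inl j => a j | inr j => b j end).
  rewrite big_split_ord /=; congr (_ + _); apply: eq_bigr => i _.
    by rewrite (unsplitK (inl i)).
  by rewrite (unsplitK (inr i)).
move=> [a ->]; rewrite big_split_ord /=.
exists (\sum_(i < m) a (lshift n i) *: v i), (\sum_(i < n) a (rshift m i) *: w i).
split; [by exists (fun i => a (lshift n i))|by exists (fun i => a (rshift m i))|].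
by congr (_ + _); apply: eq_bigr => i _;
   [rewrite (unsplitK (inl i))|rewrite (unsplitK (inr i))].
Qed.

End Subspaces.

Lemma linear_fun0 (K : fieldType) (V W : lmodType K) (f : V -> W) :
  linear f -> f 0 = 0.
Proof. by move=> fl; have := fl (-1) 0 0; rewrite scaler0 addr0 scaleN1r addNr. Qed.

Lemma fin_dim_image (K : fieldType) (V W : lmodType K) (f : V -> W) (M : set V) :
  linear f -> fin_dim M -> fin_dim (f @` M).
Proof.
move=> fl [n [v ->]]; exists n, (f \o v).
pose F : {linear V -> W} := HB.pack f (GRing.isLinear.Build _ _ _ _ f fl).
have fE (a : 'I_n -> K) :
    f (\sum_(i < n) a i *: v i) = \sum_(i < n) a i *: f (v i).
  by rewrite -[f]/(F : V -> W) linear_sum; apply: eq_bigr => i _; rewrite linearZ.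
apply/seteqP; split=> x.
  by move=> [_ [a ->] <-]; exists a; rewrite fE.
by move=> [a ->]; exists (\sum_(i < n) a i *: v i); [exists a|rewrite fE].
Qed.

Section LinearMaps.
Variables (K : fieldType) (U W : lmodType K).

Lemma linear_map_ext (f g : {linear U -> W}) : f =1 g -> f = g.
Proof.
move=> fg; have {fg} : f = g :> (U -> W) by exact/funext.
case: f g => [f [[fa] [fs]]] [g [[ga] [gs]]] /= fg; subst g.
by rewrite (Prop_irrelevance fa ga) (Prop_irrelevance fs gs).
Qed.

Definition linear_add (f g : {linear U -> W}) : {linear U -> W} := f \+ g.
Definition linear_opp (f : {linear U -> W}) : {linear U -> W} := \- f.
Definition linear_zero : {linear U -> W} := \0.
Definition linear_scale (a : K) (f : {linear U -> W}) : {linear U -> W} := a \*: f.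

HB.instance Definition _ := gen_eqMixin {linear U -> W}.
HB.instance Definition _ := gen_choiceMixin {linear U -> W}.

Lemma linear_addA : associative linear_add.
Proof. by move=> f g h; apply: linear_map_ext => x /=; rewrite addrA. Qed.
Lemma linear_addC : commutative linear_add.
Proof. by move=> f g; apply: linear_map_ext => x /=; rewrite addrC. Qed.
Lemma linear_add0 : left_id linear_zero linear_add.
Proof. by move=> f; apply: linear_map_ext => x /=; rewrite add0r. Qed.
Lemma linear_addN : left_inverse linear_zero linear_opp linear_add.
Proof. by move=> f; apply: linear_map_ext => x /=; rewrite addNr. Qed.

HB.instance Definition _ := GRing.isZmodule.Build {linear U -> W}
  linear_addA linear_addC linear_add0 linear_addN.

Lemma linear_scaleA a b f :
  linear_scale a (linear_scale b f) = linear_scale (a * b) f.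
Proof. by apply: linear_map_ext => x /=; rewrite scalerA. Qed.
Lemma linear_scale1 : left_id 1 linear_scale.
Proof. by move=> f; apply: linear_map_ext => x /=; rewrite scale1r. Qed.
Lemma linear_scaleDr : right_distributive linear_scale +%R.
Proof. by move=> a f g; apply: linear_map_ext => x /=; rewrite scalerDr. Qed.
Lemma linear_scaleDl f : {morph linear_scale^~ f : a b / a + b}.
Proof. by move=> a b; apply: linear_map_ext => x /=; rewrite scalerDl. Qed.

HB.instance Definition _ := GRing.Zmodule_isLmodule.Build K {linear U -> W}
  linear_scaleA linear_scale1 linear_scaleDr linear_scaleDl.

End LinearMaps.

Definition operator_norm (R : realType) (U W : Type) (nU : U -> R) (nW : W -> R)
  (f : U -> W) : R := sup [set nW (f x) | x in [set x | nU x <= 1]].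

Section FiniteRankOperators.
Variables (R : realType) (k : scalar_kind) (H : hilbertType R k).
Local Notation K := (scalar_field R k).

Definition finite_rank_bounded (T : H -> H) : Prop :=
  [/\ linear T, exists c, forall x, `|T x| <= c * `|x| & fin_dim (range T)].

Definition finrank_pred : {pred H -> H} := fun T => `[< finite_rank_bounded T >].

Lemma range_subspace (T : H -> H) : linear T -> is_subspace (range T).
Proof.
move=> Tl; split.
  by exists 0 => //; exact: linear_fun0.
by move=> a _ _ [x _ <-] [y _ <-]; exists (a *: x + y) => //; rewrite Tl.
Qed.

Lemma finrank_closed : submod_closed finrank_pred.
Proof.
split.
  apply/asboolP; split.
  - by move=> a x y; rewrite /= scaler0 addr0.
  - by exists 0 => x; rewrite normr0 mul0r.
  - apply: (@fin_dim_sub _ _ _ 0 (fun=> 0)); last first.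
      by move=> _ [x _ <-]; exists (fun=> 0); rewrite big_ord0.
    by apply: range_subspace => a x y; rewrite /= scaler0 addr0.
move=> a T S /asboolP [Tl [c Tc] Tr] /asboolP [Sl [d Sd] Sr].
have TSl : linear (a *: (T : H -> H) + (S : H -> H)).
  move=> b x y; rewrite /= !fctE Tl Sl !scalerDr !scalerA (mulrC b a).
  by rewrite addrACA.
apply/asboolP; split=> //.
  exists (`|a| * c + d) => x; rewrite mulrDl -mulrA.
  apply: (le_trans (ler_normD _ _)); apply: lerD; last exact: Sd.
  by rewrite normrZ ler_wpM2l.
have [n [v E]] : fin_dim [set z | exists x y, [/\ range T x, range S y & z = x + y]].
  exact: fin_dim_add.
apply: (@fin_dim_sub _ _ _ n v); first exact: range_subspace.
rewrite -E => _ [x _ <-]; exists (T (a *: x)), (S x); split.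
- by exists (a *: x).
- by exists x.
- have T0 : T 0 = 0 by exact: linear_fun0.
  by have := Tl a x 0; rewrite T0 !addr0 => ->.
Qed.

HB.instance Definition _ :=
  GRing.isSubmodClosed.Build K (H -> H) finrank_pred finrank_closed.

Record finrank_op := FinrankOp {
  finrank_fun :> H -> H;
  finrank_funP : finrank_fun \in finrank_pred
}.

HB.instance Definition _ := [isSub of finrank_op for finrank_fun].
HB.instance Definition _ := [Choice of finrank_op by <:].
HB.instance Definition _ := [SubChoice_isSubLmodule of finrank_op by <:].

Lemma finrankP (T : finrank_op) : finite_rank_bounded T.
Proof. exact/asboolP/finrank_funP. Qed.

Lemma finrank_ext (S T : finrank_op) : S =1 T -> S = T.
Proof. by move=> ST; apply: val_inj; apply/funext. Qed.

Lemma finrank_linear (T : finrank_op) : linear T.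
Proof. by case: (finrankP T). Qed.

Lemma op_mul_subproof (S T : finrank_op) : T \o S \in finrank_pred.
Proof.
have [Sl [c Sc] Sr] := finrankP S; have [Tl [d Td] _] := finrankP T.
apply/asboolP; split.
- by move=> a x y; rewrite /= Sl Tl.
- exists (`|d| * c) => x; apply: (le_trans (Td _)).
  apply: (@le_trans _ _ (`|d| * `|S x|)); last by rewrite -mulrA ler_wpM2l.
  have [->|Sx0] := eqVneq `|S x| 0; first by rewrite !mulr0.
  have Sx : 0 < `|S x| by rewrite lt_def Sx0 normr_ge0.
  rewrite ler_pM2r //.
  suff : 0 <= d by move/ger0_norm ->.
  by rewrite -(pmulr_lge0 _ Sx) (le_trans _ (Td _)).
- by rewrite -(image_comp S T); exact: (fin_dim_image (finrank_linear T) Sr).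
Qed.

(* Operators compose from left to right: S T is first S, then T. *)
Definition op_mul (S T : finrank_op) : finrank_op := FinrankOp (op_mul_subproof S T).

Local Notation "S ** T" := (op_mul S T) (at level 40, left associativity).

Lemma op_mulA (A B C : finrank_op) : A ** (B ** C) = A ** B ** C.
Proof. exact: finrank_ext. Qed.

Lemma op_mul0 (P : finrank_op) : 0 ** P = 0.
Proof.
apply: finrank_ext => x /=.
exact: linear_fun0 (finrank_linear P).
Qed.

Lemma op_mul_linear (P : finrank_op) : linear (op_mul^~ P).
Proof. by move=> a A B; apply: finrank_ext => x /=; rewrite finrank_linear. Qed.

Definition op_norm (T : finrank_op) : R :=
  operator_norm (@hnorm _ _ H) (@hnorm _ _ H) T.

Definition idempotent_op (P : finrank_op) := P ** P = P.

Definition left_ideal (P : finrank_op) : set finrank_op :=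
  [set A ** P | A in setT].

Lemma left_idealP P A : idempotent_op P -> left_ideal P A <-> A ** P = A.
Proof.
move=> PP; split=> [[B _ <-]|<-]; first by rewrite -op_mulA PP.
by exists A.
Qed.

Lemma left_ideal_subspace P : is_subspace (left_ideal P).
Proof.
split; first by exists 0; rewrite ?op_mul0.
by move=> a _ _ [A _ <-] [B _ <-]; exists (a *: A + B); rewrite ?op_mul_linear.
Qed.

Definition corner (P Q : finrank_op) : set finrank_op :=
  [set P ** A ** Q | A in setT].

Definition generates (P : finrank_op) (I : set finrank_op) :=
  idempotent_op P /\ I = left_ideal P.

Record principal_ideal := PrincipalIdeal {
  ideal_subspace :> subspace finrank_op;
  ideal_generated : exists P, generates P ideal_subspace
}.

Lemma principal_ideal_inj (I J : principal_ideal) :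
  I = J :> set finrank_op -> I = J.
Proof.
case: I J => [I Ip] [J Jp] /= /subspace_inj IJ; subst J.
by rewrite (Prop_irrelevance Ip Jp).
Qed.

Definition ideal_of (P : finrank_op) (PP : idempotent_op P) : principal_ideal :=
  @PrincipalIdeal (Subspace (left_ideal_subspace P))
    (ex_intro _ P (conj PP erefl)).

(* f is A |-> A T with T in P S Q, for idempotents P and Q that generate I
   and J. By is_rho_for, this does not depend on the choice of P and Q. *)
Definition is_rho (I J : principal_ideal) (f : elt I -> elt J) :=
  exists P T Q, [/\ generates P I, generates Q J, corner P Q T &
    forall A, elt_val (f A) = elt_val A ** T].

Lemma is_rho_for (I J : principal_ideal) (f : elt I -> elt J) P Q :
  generates P I -> generates Q J -> is_rho f ->
  exists T, corner P Q T /\ forall A, elt_val (f A) = elt_val A ** T.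
Proof.
move=> [PP IP] [QQ JQ] [P' [T [Q' [_ _ _ fE]]]].
exists (P ** T ** Q); split; first by exists T.
move=> A; have := elt_in A; rewrite IP => /(left_idealP _ PP) AP.
have := elt_in (f A); rewrite JQ => /(left_idealP _ QQ) <-.
by rewrite fE !op_mulA AP.
Qed.

Definition ideal_hom_pred (I J : principal_ideal) : {pred elt I -> elt J} :=
  fun f => `[< is_rho f >].

Lemma ideal_hom_closed (I J : principal_ideal) : submod_closed (@ideal_hom_pred I J).
Proof.
have [P IP] := ideal_generated I; have [Q JQ] := ideal_generated J.
split.
  apply/asboolP; exists P, 0, Q; split=> //.
    exists 0 => //; rewrite -op_mulA op_mul0; exact: finrank_ext.
  by move=> A; apply: finrank_ext => x.
move=> a f g /asboolP /(is_rho_for IP JQ) [T [[T' _ TE] fE]].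
move=> /asboolP /(is_rho_for IP JQ) [S [[S' _ SE] gE]].
apply/asboolP; exists P, (a *: T + S), Q; split=> //.
  exists (a *: T' + S') => //; rewrite -TE -SE; apply: finrank_ext => x /=.
  by rewrite !finrank_linear.
by move=> A; apply: finrank_ext => x /=; rewrite !fctE /= fE gE.
Qed.

HB.instance Definition _ (I J : principal_ideal) := GRing.isSubmodClosed.Build K (elt I -> elt J)
  (@ideal_hom_pred I J) (ideal_hom_closed I J).

Record ideal_hom (I J : principal_ideal) := IdealHom {
  ideal_hom_fun :> elt I -> elt J;
  ideal_hom_funP : ideal_hom_fun \in @ideal_hom_pred I J
}.

HB.instance Definition _ (I J : principal_ideal) := [isSub of ideal_hom I J for @ideal_hom_fun I J].
HB.instance Definition _ (I J : principal_ideal) := [Choice of ideal_hom I J by <:].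
HB.instance Definition _ (I J : principal_ideal) := [SubChoice_isSubLmodule of ideal_hom I J by <:].

Lemma ideal_homP (I J : principal_ideal) (f : ideal_hom I J) : is_rho f.
Proof. exact/asboolP/ideal_hom_funP. Qed.

Lemma ideal_hom_ext (I J : principal_ideal) (f g : ideal_hom I J) :
  (forall A, elt_val (f A) = elt_val (g A)) -> f = g.
Proof. by move=> fg; apply: val_inj; apply/funext => A; exact/elt_inj/fg. Qed.

Lemma ideal_id_subproof (I : principal_ideal) : (fun A : elt I => A) \in @ideal_hom_pred I I.
Proof.
have [P [PP IP]] := ideal_generated I.
apply/asboolP; exists P, P, P; split=> //.
  by exists P => //; rewrite !PP.
by move=> A; have := elt_in A; rewrite IP => /(left_idealP _ PP) ->.
Qed.

Definition ideal_id (I : principal_ideal) : ideal_hom I I := IdealHom (ideal_id_subproof I).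

Lemma ideal_comp_subproof (I J L : principal_ideal) (f : ideal_hom I J) (g : ideal_hom J L) :
  (fun A => g (f A)) \in @ideal_hom_pred I L.
Proof.
have [P IP] := ideal_generated I; have [Q JQ] := ideal_generated J.
have [S LS] := ideal_generated L.
have [T [[T' _ TE] fE]] := is_rho_for IP JQ (ideal_homP f).
have [U [[U' _ UE] gE]] := is_rho_for JQ LS (ideal_homP g).
apply/asboolP; exists P, (T ** U), S; split=> //.
  by exists (T' ** Q ** Q ** U') => //; rewrite -TE -UE !op_mulA.
by move=> A; rewrite gE fE op_mulA.
Qed.

Definition ideal_comp (I J L : principal_ideal) (f : ideal_hom I J) (g : ideal_hom J L) :
  ideal_hom I L := IdealHom (ideal_comp_subproof f g).

Lemma rho_subproof P Q (PP : idempotent_op P) (QQ : idempotent_op Q) T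
    (PTQ : corner P Q T) (A : elt (ideal_of PP)) :
  left_ideal Q (elt_val A ** T).
Proof. by case: PTQ => T' _ <-; exists (elt_val A ** (P ** T')) => //; rewrite !op_mulA. Qed.

Lemma rho_is_rho P Q (PP : idempotent_op P) (QQ : idempotent_op Q) T
    (PTQ : corner P Q T) :
  (fun A : elt (ideal_of PP) => @to_elt _ _ (ideal_of QQ) _ (rho_subproof QQ PTQ A))
    \in @ideal_hom_pred (ideal_of PP) (ideal_of QQ).
Proof. by apply/asboolP; exists P, T, Q. Qed.

Definition rho P Q (PP : idempotent_op P) (QQ : idempotent_op Q) T
    (PTQ : corner P Q T) : ideal_hom (ideal_of PP) (ideal_of QQ) :=
  IdealHom (rho_is_rho PP QQ PTQ).

Record fin_subspace := FinSubspace {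
  fin_subspace_val :> subspace H;
  fin_subspaceP : fin_dim fin_subspace_val
}.

Lemma fin_subspace_inj (M N : fin_subspace) : M = N :> set H -> M = N.
Proof.
case: M N => [M Mf] [N Nf] /= /subspace_inj MN; subst N.
by rewrite (Prop_irrelevance Mf Nf).
Qed.

Local Notation "'[ x , y ]" := (inner H x y).

Lemma innerC0 (x y : H) : '[x, y] = 0 -> '[y, x] = 0.
Proof.
move=> xy0; have := @hermitian_subproof _ _ _ _ (inner H) y x => /= ->.
rewrite xy0 expr0 mul1r.
by rewrite /scalar_conj; case: (k) => //; rewrite rmorph0.
Qed.

Lemma inner_eq0 (x : H) : '[x, x] = 0 -> x = 0.
Proof. by rewrite -inner_norm => /eqP; rewrite sqrf_eq0 normr_eq0 => /eqP. Qed.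

Lemma orth_span_exists n (v : 'I_n -> H) (x : H) :
  exists p, lspan v p /\ forall y, lspan v y -> '[y, x - p] = 0.
Proof.
elim: n v x => [|n IHn] v x.
  exists 0; split; first by exists (fun=> 0); rewrite big_ord0.
  by move=> y [a ->]; rewrite big_ord0 linear0l.
rewrite (fcons_lift v).
move: (v ord0) (fun i : 'I_n => v (lift ord0 i)) => u {}v.
have [S0 Sl] := span_subspace v.
have [q [vq uq]] := IHn v u; have [p [vp xp]] := IHn v x.
have [w uE] : exists w, u = w + q by exists (u - q); rewrite subrK.
rewrite {}uE {u} addrK in uq *.
have [->|w0] := eqVneq w 0.
  rewrite add0r.
  exists p; split; first by apply/span_fcons; exists 0, p; rewrite scale0r add0r.
  by move=> y /span_fcons [c [s [vs ->]]]; apply: xp; exact: Sl.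
pose c := '[x - p, w] / '[w, w].
have ww0 : '[w, w] != 0 by apply: contra w0 => /eqP /inner_eq0 ->.
exists (c *: w + p); split.
  apply/span_fcons; exists c, (p - c *: q); split.
    by rewrite addrC -scaleNr; exact: Sl.
  by rewrite scalerDr addrACA subrr addr0.
have wr : '[w, x - (c *: w + p)] = 0.
  apply: innerC0; rewrite opprD addrA addrAC.
  by rewrite linearBl linearZl_LR /= /c divfK // subrr.
move=> y /span_fcons [d [s [vs ->]]].
rewrite scalerDr -addrA linearDl linearZl_LR /= wr mulr0 add0r.
set t := d *: q + s; have vt : lspan v t by exact: Sl.
apply: innerC0; rewrite opprD addrA addrAC linearBl linearZl_LR /=.
by rewrite (innerC0 (xp _ vt)) (innerC0 (uq _ vt)) mulr0 subr0.
Qed.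

Definition is_orth_proj (M : set H) (P : H -> H) :=
  forall x, M (P x) /\ forall y, M y -> '[y, x - P x] = 0.

Lemma orth_proj_unique (M : set H) x p q : is_subspace M ->
  M p -> (forall y, M y -> '[y, x - p] = 0) ->
  M q -> (forall y, M y -> '[y, x - q] = 0) -> p = q.
Proof.
move=> [_ Ml] Mp xp Mq xq; apply/eqP; rewrite -subr_eq0; apply/eqP.
have Mpq : M (p - q) by rewrite addrC -scaleN1r; exact: Ml.
have E : p - q = (x - q) - (x - p) by rewrite opprB [RHS]addrC addrA subrK.
by apply: inner_eq0; rewrite [X in '[_, X]]E linearBr /= xp // xq // subrr.
Qed.

Lemma inner_pythagoras (p r : H) : '[p, r] = 0 -> '[p, p] <= '[r + p, r + p].
Proof.
move=> pr; rewrite linearDl !linearDr /= pr (innerC0 pr).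
by rewrite addr0 add0r lerDr -inner_norm exprn_ge0.
Qed.

Lemma orth_proj_exists (M : fin_subspace) :
  exists P : finrank_op, is_orth_proj (M : set H) P.
Proof.
have [n [v Mv]] := fin_subspaceP M.
have Msub := subspaceP M; have [M0 Ml] := Msub.
have [P PM] : exists P, is_orth_proj (M : set H) P.
  have [P PE] := boolp.choice (orth_span_exists v).
  by exists P => x; rewrite Mv; exact: PE.
have Pid y : subspace_set M y -> P y = y.
  move=> My; have [MP Py] := PM y; apply: (orth_proj_unique Msub MP Py My).
  by move=> z _; rewrite subrr linear0r.
have Pl : linear P.
  move=> a x y; have [MPx Px] := PM x; have [MPy Py] := PM y.
  have [MPz Pz] := PM (a *: x + y).
  apply: (orth_proj_unique Msub MPz Pz); first exact: Ml.
  move=> z Mz; apply: innerC0; rewrite opprD addrACA -scalerBr.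
  by rewrite linearDl linearZl_LR /= (innerC0 (Px _ Mz)) (innerC0 (Py _ Mz)) mulr0 addr0.
have PF : P \in finrank_pred.
  apply/asboolP; split=> //.
    exists 1 => x; rewrite mul1r -(@ler_pXn2r _ 2) ?nnegrE // !inner_norm.
    have [MPx /(_ _ MPx) Px] := PM x.
    by have := inner_pythagoras Px; rewrite subrK.
  rewrite (_ : range P = subspace_set M); first exact: fin_subspaceP; apply/seteqP; split=> y.
    by move=> [x _ <-]; have [] := PM x.
  by move=> My; exists y => //; exact: Pid.
by exists (FinrankOp PF).
Qed.

Definition orth_proj (M : fin_subspace) : finrank_op := sval (cid (orth_proj_exists M)).

Lemma orth_projP (M : fin_subspace) : is_orth_proj (M : set H) (orth_proj M).
Proof. exact: (svalP (cid (orth_proj_exists M))). Qed.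

Lemma orth_proj_idempotent (M : fin_subspace) : idempotent_op (orth_proj M).
Proof.
apply: finrank_ext => x /=; have [MP _] := orth_projP M x.
have [MPP PP] := orth_projP M (orth_proj M x).
apply: (orth_proj_unique (subspaceP M) MPP PP MP) => y _.
by rewrite subrr linear0r.
Qed.

Definition proj_ideal (M : fin_subspace) : principal_ideal :=
  ideal_of (orth_proj_idempotent M).

Lemma ideal_hom_rho (M N : fin_subspace)
    (f : ideal_hom (proj_ideal M) (proj_ideal N)) :
  exists T, exists PTQ : corner (orth_proj M) (orth_proj N) T,
    f = rho (orth_proj_idempotent M) (orth_proj_idempotent N) PTQ.
Proof.
have gen L : generates (orth_proj L) (proj_ideal L).
  by split=> //; exact: orth_proj_idempotent.
have [T [PTQ fE]] := is_rho_for (gen M) (gen N) (ideal_homP f).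
by exists T, PTQ; apply: ideal_hom_ext => A; rewrite fE.
Qed.

(* By ideal_hom_op_rho, this is the only T in P_M S P_N such that
   f = rho(P_M, T, P_N). The idempotents must be the orthogonal projections:
   other generators of the same ideals give operators of different norm. *)
Definition ideal_hom_op (M N : fin_subspace)
    (f : ideal_hom (proj_ideal M) (proj_ideal N)) : finrank_op :=
  sval (cid (ideal_hom_rho f)).

Definition ideal_hom_norm (M N : fin_subspace)
    (f : ideal_hom (proj_ideal M) (proj_ideal N)) : R :=
  op_norm (ideal_hom_op f).

Lemma ideal_hom_op_rho (M N : fin_subspace) T
    (PTQ : corner (orth_proj M) (orth_proj N) T) :
  ideal_hom_op (rho (orth_proj_idempotent M) (orth_proj_idempotent N) PTQ) = T.
Proof.
rewrite /ideal_hom_op; case: cid => S /= [PSQ].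
have MP : left_ideal (orth_proj M) (orth_proj M).
  by apply/left_idealP; exact: orth_proj_idempotent.
move/(congr1 (fun f : ideal_hom (proj_ideal M) (proj_ideal N) =>
  elt_val (f (to_elt (MP : subspace_set (proj_ideal M) _))))) => /=.
have [T' _ <-] := PTQ; have [S' _ <-] := PSQ.
by rewrite !op_mulA orth_proj_idempotent.
Qed.

Definition subspace_hom (M N : fin_subspace) := {linear elt M -> elt N}.

Definition subspace_hom_norm (M N : fin_subspace) (f : {linear elt M -> elt N}) : R :=
  operator_norm (fun x : elt M => hnorm (elt_val x : H))
                (fun y : elt N => hnorm (elt_val y : H)) f.

End FiniteRankOperators.

Section Categories.

(* A category with a class of distinguished morphisms, the inclusions; their
   axioms are in has_subobjects. Composition is in diagrammatic order:
   comp f g is first f, then g. *)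
Record category := Category {
  obj :> Type;
  hom : obj -> obj -> Type;
  idm : forall a, hom a a;
  comp : forall a b c, hom a b -> hom b c -> hom a c;
  comp_idl : forall a b (f : hom a b), comp (idm a) f = f;
  comp_idr : forall a b (f : hom a b), comp f (idm b) = f;
  compA : forall a b c d (f : hom a b) (g : hom b c) (h : hom c d),
    comp f (comp g h) = comp (comp f g) h;
  inclusion : forall a b, hom a b -> Prop
}.

Definition mono (C : category) (a b : C) (f : hom a b) :=
  forall (c : C) (g h : hom c a), comp g f = comp h f -> g = h.

Definition iso (C : category) (a b : C) (f : hom a b) :=
  exists g : hom b a, comp f g = idm a /\ comp g f = idm b.

Definition retraction (C : category) (a b : C) (q : hom a b) :=
  exists j : hom b a, inclusion j /\ comp j q = idm b.

Record has_subobjects (C : category) : Prop := HasSubobjects {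
  inclusion_id : forall a : C, inclusion (idm a);
  inclusion_comp : forall (a b c : C) (f : hom a b) (g : hom b c),
    inclusion f -> inclusion g -> inclusion (comp f g);
  inclusion_thin : forall (a b : C) (f g : hom a b),
    inclusion f -> inclusion g -> f = g;
  inclusion_antisym : forall (a b : C) (f : hom a b) (g : hom b a),
    inclusion f -> inclusion g -> a = b;
  inclusion_mono : forall (a b : C) (f : hom a b), inclusion f -> mono f;
  inclusion_cancel : forall (a b c : C) (f : hom a c) (h : hom a b) (g : hom b c),
    inclusion f -> inclusion g -> f = comp h g -> inclusion h
}.

Definition has_normal_factorization (C : category) (a b : C) (f : hom a b) :=
  exists (c d : C) (q : hom a c) (u : hom c d) (j : hom d b),
    [/\ retraction q, iso u, inclusion j & f = comp (comp q u) j].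

Definition is_cone (C : category) (d : C) (gamma : forall c : C, hom c d) :=
  forall (c' c : C) (j : hom c' c), inclusion j -> comp j (gamma c) = gamma c'.

Definition is_normal_cone (C : category) (d : C) (gamma : forall c : C, hom c d) :=
  is_cone gamma /\ exists c, iso (gamma c).

Record is_normal_category (C : category) : Prop := IsNormalCategory {
  normal_subobjects : has_subobjects C;
  normal_factorization : forall (a b : C) (f : hom a b),
    has_normal_factorization f;
  normal_split : forall (a b : C) (j : hom a b), inclusion j ->
    exists q : hom b a, comp j q = idm a;
  normal_cones : forall d : C, exists gamma : forall c : C, hom c d,
    is_normal_cone gamma /\ gamma d = idm d
}.

Record functor (C D : category) := Functor {
  fobj :> C -> D;
  fmap : forall a b : C, hom a b -> hom (fobj a) (fobj b);
  fmap_id : forall a : C, fmap (idm a) = idm (fobj a);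
  fmap_comp : forall (a b c : C) (f : hom a b) (g : hom b c),
    fmap (comp f g) = comp (fmap f) (fmap g)
}.

Definition functor_id (C : category) : functor C C :=
  @Functor C C (fun a => a) (fun _ _ f => f) (fun _ => erefl)
    (fun _ _ _ _ _ => erefl).

Lemma functor_comp_id (C D E : category) (F : functor C D) (G : functor D E) a :
  fmap G (fmap F (idm a)) = idm (G (F a)).
Proof. by rewrite !fmap_id. Qed.

Lemma functor_comp_comp (C D E : category) (F : functor C D) (G : functor D E)
    (a b c : C) (f : hom a b) (g : hom b c) :
  fmap G (fmap F (comp f g)) = comp (fmap G (fmap F f)) (fmap G (fmap F g)).
Proof. by rewrite !fmap_comp. Qed.

(* First F, then G. *)
Definition functor_comp (C D E : category) (F : functor C D) (G : functor D E) :
    functor C E :=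
  @Functor C E (fun a => G (F a)) (fun a b f => fmap G (fmap F f))
    (functor_comp_id F G) (functor_comp_comp F G).

Definition inclusion_preserving (C D : category) (F : functor C D) :=
  forall (a b : C) (f : hom a b), inclusion f -> inclusion (fmap F f).

Record normal_isomorphism (C D : category) := NormalIsomorphism {
  iso_functor :> functor C D;
  iso_inverse : functor D C;
  iso_inclusion : inclusion_preserving iso_functor;
  iso_inverse_inclusion : inclusion_preserving iso_inverse;
  iso_functorK : functor_comp iso_functor iso_inverse = functor_id C;
  iso_inverseK : functor_comp iso_inverse iso_functor = functor_id D
}.

Definition hom_cast (C : category) (a a' b b' : C) (ea : a = a') (eb : b = b')
  (f : hom a b) : hom a' b' := ecast x (hom x b') ea (ecast y (hom a y) eb f).

End Categories.

Section MainCategories.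
Variables (R : realType) (k : scalar_kind) (H : hilbertType R k).

Definition ideal_category : category.
Proof.
refine (@Category (principal_ideal H) (@ideal_hom R k H) (@ideal_id R k H)
  (@ideal_comp R k H) _ _ _
  (fun I J f => forall A : elt I, elt_val (f A) = elt_val A)).
- by move=> I J f; exact: ideal_hom_ext.
- by move=> I J f; exact: ideal_hom_ext.
- by move=> I J L N f g h; exact: ideal_hom_ext.
Defined.

Definition subspace_category : category.
Proof.
refine (@Category (fin_subspace H) (@subspace_hom R k H)
  (fun M => idfun : {linear elt M -> elt M})
  (fun M N L (f : {linear elt M -> elt N}) (g : {linear elt N -> elt L}) =>
    (g \o f : {linear elt M -> elt L})) _ _ _
  (fun M N f => forall x : elt M, elt_val (f x) = elt_val x)).
- by move=> M N f; exact: linear_map_ext.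
- by move=> M N f; exact: linear_map_ext.
- by move=> M N L Q f g h; exact: linear_map_ext.
Defined.

Definition normed_space_isomorphism (K : fieldType) (U W : lmodType K)
    (nU : U -> R) (nW : W -> R) (phi : U -> W) : Prop :=
  [/\ linear phi, bijective phi & forall x, nW (phi x) = nU x].

(* The action of F on morphisms, with its values moved from
   hom (F (S P_M)) (F (S P_N)) to hom M N. *)
Definition hom_restriction (F : functor ideal_category subspace_category)
    (eF : forall M : fin_subspace H, F (proj_ideal M) = M) (M N : fin_subspace H)
    (f : ideal_hom (proj_ideal M) (proj_ideal N)) : {linear elt M -> elt N} :=
  hom_cast (eF M) (eF N) (@fmap _ _ F (proj_ideal M) (proj_ideal N) f).

End MainCategories.

(* Main.v *)
(* An ideal I = S P is determined by the subspace M = R(P), as the set of A in S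
   with range in M, and M is recovered as the set of all values A x with A in I.
   A morphism A |-> A T from S P to S Q corresponds to x |-> T x from R(P) to
   R(Q), that is, to A x |-> (f A) x, which does not mention P, Q or T.
   Conversely, a linear map g : M -> N comes from the operator
   x |-> g (P_M x), which is bounded because linear maps on a finite-dimensional
   subspace are. When T = P_M T, the operator T takes the same values on the unit
   ball of H as on that of M, since P_M maps the former onto the latter; hence
   the equality of norms. Normality is checked for subspaces and reflected along
   the isomorphism. *)

From HB Require Import structures.
From mathcomp Require Import all_boot all_order all_algebra.
From mathcomp Require Import sesquilinear complex.
From mathcomp Require Import boolp classical_sets reals.
From mathcomp Require Import topology normedtype.
Require Import Defs.

Set Implicit Arguments.
Unset Strict Implicit.
Unset Printing Implicit Defensive.
Import Order.TTheory GRing.Theory Num.Theory.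
Local Open Scope classical_set_scope.
Local Open Scope ring_scope.

(** * Equality of functors, and transfer of normality along a functor *)

Section CategoryTheory.

(** Morphism values of [F] and [G] live in different types until [F a = G a] is used, hence the
    transport. Once the object maps are identified, each [e a] is [erefl] by proof irrelevance and
    the transport disappears. *)
Lemma functor_eq (C D : category) (F G : functor C D) (e : forall a, F a = G a) :
  (forall a b (f : hom a b), hom_cast (e a) (e b) (fmap F f) = fmap G f) -> F = G.
Proof.
case: F G e => [F Ff Fi Fc] [G Gf Gi Gc] /= e.
have FG : F = G by exact/funext.
subst G => FfE; have {FfE} Ef : Ff = Gf.
  apply: functional_extensionality_dep => a.
  apply: functional_extensionality_dep => b.
  apply/funext => f; rewrite -FfE.
  by rewrite (Prop_irrelevance (e a) erefl) (Prop_irrelevance (e b) erefl).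
subst Gf.
by rewrite (Prop_irrelevance Fi Gi) (Prop_irrelevance Fc Gc).
Qed.

Lemma iso_reflect (C D : category) (F : functor C D) :
  (forall a b (f g : @hom C a b), fmap F f = fmap F g -> f = g) ->
  (forall a b (g : hom (F a) (F b)), exists f : hom a b, fmap F f = g) ->
  forall (a b : C) (f : hom a b), iso (fmap F f) -> iso f.
Proof.
move=> Finj Fsurj a b f [g' []]; have [g <-] := Fsurj _ _ g' => fg gf.
by exists g; split; apply: Finj; rewrite fmap_comp fmap_id.
Qed.

(** Fullness and surjectivity on objects lift every witness from [D] to [C]; faithfulness lets each
    equation be checked after applying [F]. Injectivity on objects gives antisymmetry of inclusions,
    which concludes a strict equality. *)
Lemma normal_category_reflect (C D : category) (F : functor C D) :
  (forall a b : C, F a = F b -> a = b) ->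
  (forall d : D, exists a, F a = d) ->
  (forall a b (f g : @hom C a b), fmap F f = fmap F g -> f = g) ->
  (forall a b (g : hom (F a) (F b)), exists f : hom a b, fmap F f = g) ->
  (forall a b (f : @hom C a b), inclusion f <-> inclusion (fmap F f)) ->
  is_normal_category D -> is_normal_category C.
Proof.
move=> Finjo Fsurjo Finj Fsurj Finc.
move=> [[Iid Icomp Ithin Ianti Imono Icanc] fact split cones].
have isoF := iso_reflect Finj Fsurj.
split.
- split.
  + by move=> a; apply/Finc; rewrite fmap_id; exact: Iid.
  + move=> a b c f g /Finc If /Finc Ig; apply/Finc; rewrite fmap_comp.
    exact: Icomp.
  + by move=> a b f g /Finc If /Finc Ig; apply: Finj; exact: Ithin.
  + by move=> a b f g /Finc If /Finc Ig; apply: Finjo; exact: Ianti If Ig.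
  + move=> a b f /Finc /Imono If c g h gh; apply/Finj/If.
    by rewrite -!fmap_comp gh.
  + move=> a b c f h g /Finc If /Finc Ig fE; apply/Finc.
    by apply: (Icanc _ _ _ _ _ _ If Ig); rewrite fE fmap_comp.
- move=> a b f; have [c' [d' [q' [u' [j' []]]]]] := fact _ _ (fmap F f).
  have [c cE] := Fsurjo c'; subst c'; have [d dE] := Fsurjo d'; subst d'.
  have [q <-] := Fsurj _ _ q'; have [u <-] := Fsurj _ _ u'.
  have [j <-] := Fsurj _ _ j' => -[i' []].
  have [i <-] := Fsurj _ _ i' => Ii iq Uu Ij fE.
  exists c, d, q, u, j; split; [|exact: isoF|exact/Finc|].
    by exists i; split; [exact/Finc|apply: Finj; rewrite fmap_comp fmap_id].
  by apply: Finj; rewrite fE !fmap_comp.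
- move=> a b j /Finc /split [q']; have [q <-] := Fsurj _ _ q' => jq.
  by exists q; apply: Finj; rewrite fmap_comp fmap_id.
- move=> d; have [gamma' [[gC [c' gI]] gd]] := cones (F d).
  (* The components are lifted one by one by choice; their compatibility with inclusions is then
     inherited from [gamma'] by faithfulness. *)
  pose gamma c := sval (cid (Fsurj _ _ (gamma' (F c)))).
  have gammaE c : fmap F (gamma c) = gamma' (F c) by rewrite /gamma; case: cid.
  exists gamma; split; last by apply: Finj; rewrite gammaE gd fmap_id.
  split.
    by move=> a b j /Finc Ij; apply: Finj; rewrite fmap_comp !gammaE; exact: gC.
  have [c cE] := Fsurjo c'; subst c'.
  by exists c; apply: isoF; rewrite gammaE.
Qed.

End CategoryTheory.

(** * Restriction of a linear map to subspaces *)

Section Restriction.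
Variables (K : fieldType) (V : lmodType K).

Lemma elt_valD (M : subspace V) a (x y : elt M) :
  elt_val (a *: x + y) = a *: elt_val x + elt_val y.
Proof. by []. Qed.

Section Restrict.
Variables (M N : subspace V) (T : V -> V).
Hypotheses (Tl : linear T) (TMN : forall x, subspace_set M x -> subspace_set N (T x)).

Definition restrict_fun (x : elt M) : elt N := to_elt (TMN (elt_in x)).

Lemma restrict_linear : linear restrict_fun.
Proof. by move=> a x y; apply: elt_inj => /=; rewrite Tl. Qed.

Definition restrict : {linear elt M -> elt N} :=
  HB.pack restrict_fun (GRing.isLinear.Build _ _ _ _ restrict_fun restrict_linear).

Lemma restrictE x : elt_val (restrict x) = T (elt_val x).
Proof. by []. Qed.

End Restrict.
End Restriction.

(** * Orthogonal projections, boundedness, and extension of maps of subspaces to operators *)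

Section FiniteDimensional.
Variables (R : realType) (k : scalar_kind) (H : hilbertType R k).
Local Notation K := (scalar_field R k).
Local Notation "'[ x , y ]" := (inner H x y).

Lemma pythagoras_norm_le (x y : H) : '[x, y] = 0 -> `|x| <= `|y + x|.
Proof.
move=> xy; rewrite -(@ler_pXn2r _ 2) ?nnegrE // !inner_norm.
exact: inner_pythagoras.
Qed.

Lemma orth_proj_norm_le (M : fin_subspace H) x : `|orth_proj M x| <= `|x|.
Proof.
have [MPx /(_ _ MPx) Px] := orth_projP M x.
by have := pythagoras_norm_le Px; rewrite subrK.
Qed.

Lemma orth_proj_id (M : fin_subspace H) x : subspace_set M x -> orth_proj M x = x.
Proof.
move=> Mx; have [MP Px] := orth_projP M x.
apply: (orth_proj_unique (subspaceP M) MP Px Mx) => z _.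
by rewrite subrr linear0r.
Qed.

Lemma orth_proj_in (M : fin_subspace H) x : subspace_set M (orth_proj M x).
Proof. by have [] := orth_projP M x. Qed.

(* Split off the component of the first vector orthogonal to the span of the
   others: both summands of a vector of the span are bounded by its norm. *)
Lemma span_linear_bounded (W : normedModType K) n (v : 'I_n -> H) (f : H -> W) :
  (forall a x y, lspan v x -> lspan v y -> f (a *: x + y) = a *: f x + f y) ->
  exists2 c, 0 <= c & forall x, lspan v x -> `|f x| <= c * `|x|.
Proof.
elim: n v => [|n IHn] v fl.
  exists 0 => // x [a ->]; rewrite big_ord0 normr0 mulr0.
  have v0 : lspan v 0 by have [] := span_subspace v.
  have := fl (-1) _ _ v0 v0; rewrite scaler0 addr0 scaleN1r addNr => ->.
  by rewrite normr0.
move: fl; rewrite (fcons_lift v).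
move: (v ord0) (fun i : 'I_n => v (lift ord0 i)) => u {}v fl.
have [S0 Sl] := span_subspace v.
have [U0 Ul] := span_subspace (fcons u v).
have vu s : lspan v s -> lspan (fcons u v) s.
  by move=> vs; apply/span_fcons; exists 0, s; rewrite scale0r add0r.
have [|c c0 fc] := IHn v; first by move=> a x y /vu vx /vu vy; exact: fl.
have [q [vq uq]] := orth_span_exists v u.
pose w := u - q.
have fw : lspan (fcons u v) w.
  apply/span_fcons; exists 1, (- q); rewrite scale1r; split=> //.
  by rewrite -scaleN1r -[_ *: q]addr0; exact: Sl.
have decomp x : lspan (fcons u v) x -> exists b s, lspan v s /\ x = b *: w + s.
  move=> /span_fcons [b [s [vs ->]]]; exists b, (b *: q + s).
  by split; [exact: Sl|rewrite /w scalerBr addrA subrK].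
(* The quotient bounds the contribution of [b *: w], and [c] that of [s]. If [w = 0], then [f w = 0]
   and the first contribution vanishes. *)
exists (`|f w| / `|w| + c); first by rewrite addr_ge0 ?divr_ge0.
move=> _ /decomp [b [s [vs ->]]]; rewrite fl //; last exact: vu.
have ws : '[s, b *: w] = 0.
  by apply: innerC0; rewrite linearZl_LR /= (innerC0 (uq _ vs)) mulr0.
have sx : `|s| <= `|b *: w + s| by exact: pythagoras_norm_le.
have wx : `|b *: w| <= `|b *: w + s|.
  by rewrite addrC; apply/pythagoras_norm_le/innerC0.
apply: (le_trans (ler_normD _ _)); rewrite mulrDl; apply: lerD; last first.
  by apply: (le_trans (fc _ vs)); rewrite ler_wpM2l.
have [w0|w0] := eqVneq w 0.
  have -> : f w = 0.
    have := fl (-1) _ _ U0 U0.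
    by rewrite w0 scaler0 addr0 scaleN1r addNr => ->.
  by rewrite scaler0 normr0 mul0r mul0r.
apply: (@le_trans _ _ (`|f w| / `|w| * `|b *: w|)); last first.
  by rewrite ler_wpM2l ?divr_ge0.
by rewrite !normrZ mulrCA -mulrA mulVf ?mulr1 ?normr_eq0 // mulrC.
Qed.

Lemma elt_linear_bounded (M N : fin_subspace H) (g : {linear elt M -> elt N}) :
  exists2 c, 0 <= c & forall x : elt M, `|elt_val (g x)| <= c * `|elt_val x|.
Proof.
have [n [v Mv]] := fin_subspaceP M.
(* Precomposing with [P_M] makes [g] a function on all of [H], as [span_linear_bounded] requires,
   and leaves its values on [M] unchanged. *)
pose f x : H := elt_val (g (to_elt (orth_proj_in M x))).
have [|c c0 fc] := @span_linear_bounded H _ v f.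
  move=> a x y _ _; rewrite /f -elt_valD -linearP; congr (elt_val (g _)).
  by apply: elt_inj; rewrite elt_valD /= finrank_linear.
exists c => // x; rewrite (_ : elt_val (g x) = f (elt_val x)); last first.
  rewrite /f; congr (elt_val (g _)); apply: elt_inj => /=.
  by rewrite orth_proj_id //; exact: elt_in.
by apply: fc; rewrite -Mv; exact: elt_in.
Qed.

Section Extension.
Variables (M N : fin_subspace H) (g : {linear elt M -> elt N}).

Definition extension_fun (x : H) : H := elt_val (g (to_elt (orth_proj_in M x))).

Lemma extension_linear : linear extension_fun.
Proof.
move=> a x y; rewrite /extension_fun -elt_valD -linearP.
by congr (elt_val (g _)); apply: elt_inj; rewrite elt_valD /= finrank_linear.
Qed.

(** A bound for [g] is also one for the extension because [P_M] is a contraction; the range is a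
    subspace of [N]. *)
Lemma extension_finrank : extension_fun \in @finrank_pred R k H.
Proof.
apply/asboolP; split; first exact: extension_linear.
  have [c c0 gc] := elt_linear_bounded g; exists c => x.
  by apply: (le_trans (gc _)); rewrite ler_wpM2l //; exact: orth_proj_norm_le.
have [n [w Nw]] := fin_subspaceP N.
apply: (@fin_dim_sub _ _ _ n w); first exact: range_subspace extension_linear.
by rewrite -Nw => _ [x _ <-]; exact: elt_in.
Qed.

Definition extension : finrank_op H := FinrankOp extension_finrank.

Lemma extensionE (x : elt M) : extension (elt_val x) = elt_val (g x).
Proof.
rewrite /= /extension_fun; congr (elt_val (g _)); apply: elt_inj => /=.
by rewrite orth_proj_id //; exact: elt_in.
Qed.

Lemma extension_in x : subspace_set N (extension x).
Proof. exact: elt_in. Qed.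

End Extension.

(** Makes objects of the category out of the kernel, complement and image in the normal
    factorization. *)
Lemma fin_subspace_of_sub (M : fin_subspace H) (A : set H) :
  is_subspace A -> A `<=` M -> exists L : fin_subspace H, L = A :> set H.
Proof.
move=> As AM; have [n [v Mv]] := fin_subspaceP M.
rewrite Mv in AM.
by exists (@FinSubspace _ _ _ (Subspace As) (fin_dim_sub As AM)).
Qed.

End FiniteDimensional.

(** * The correspondence between ideals and subspaces, on objects and on morphisms *)

Section Carrier.
Variables (R : realType) (k : scalar_kind) (H : hilbertType R k).
Local Notation "S ** T" := (op_mul S T) (at level 40, left associativity).
Implicit Types (I J L : principal_ideal H) (M N : fin_subspace H).

Definition ideal_carrier I : set H :=
  [set y | exists A x, subspace_set I A /\ A x = y].

(** With composition from left to right, [A ** P = A] says that [P] fixes every value of [A].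
    Conversely [P] lies in its own ideal, so each fixed point [y] is the value [P y]. *)
Lemma ideal_carrier_generated P I :
  generates P I -> forall y, ideal_carrier I y <-> P y = y.
Proof.
move=> [PP IP] y; split=> [[A [x [IA <-]]]|Py].
  by move: IA; rewrite IP => /(left_idealP _ PP) {2}<-.
by exists P, y; split=> //; rewrite IP; apply/(left_idealP _ PP).
Qed.

Lemma ideal_carrier_subspace I : is_subspace (ideal_carrier I).
Proof.
have [P /ideal_carrier_generated IP] := ideal_generated I; split.
  by apply/IP; exact: linear_fun0 (finrank_linear P).
by move=> a x y /IP Px /IP Py; apply/IP; rewrite finrank_linear Px Py.
Qed.

Lemma ideal_carrier_fin_dim I : fin_dim (ideal_carrier I).
Proof.
have [P IP] := ideal_generated I; have [_ _ [n [v Pv]]] := finrankP P.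
apply: (fin_dim_sub (v := v)); first exact: ideal_carrier_subspace.
by rewrite -Pv => y /(ideal_carrier_generated IP) Py; exists y.
Qed.

Definition carrier I : fin_subspace H :=
  @FinSubspace _ _ _ (Subspace (ideal_carrier_subspace I)) (ideal_carrier_fin_dim I).

Lemma carrierP I A :
  subspace_set I A <-> forall x, subspace_set (carrier I) (A x).
Proof.
split=> [IA x|AI]; first by exists A, x.
have [P IP] := ideal_generated I; case: (IP) => [PP ->].
apply/(left_idealP _ PP)/finrank_ext => x /=.
exact/(ideal_carrier_generated IP)/AI.
Qed.

Lemma proj_idealP M A :
  subspace_set (proj_ideal M) A <-> forall x, subspace_set M (A x).
Proof.
split=> [/(left_idealP _ (orth_proj_idempotent M)) <- x|AM].
  exact: orth_proj_in.
apply/(left_idealP _ (orth_proj_idempotent M))/finrank_ext => x /=.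
exact/orth_proj_id/AM.
Qed.

Lemma carrier_proj_ideal M : carrier (proj_ideal M) = M.
Proof.
have gM : generates (orth_proj M) (proj_ideal M).
  by split=> //; exact: orth_proj_idempotent.
apply: fin_subspace_inj; apply/seteqP; split=> x.
  by move=> /(ideal_carrier_generated gM) <-; exact: orth_proj_in.
by move=> Mx; apply/(ideal_carrier_generated gM); exact: orth_proj_id.
Qed.

Lemma proj_ideal_carrier I : proj_ideal (carrier I) = I.
Proof.
apply: principal_ideal_inj; apply/seteqP; split=> A.
  by move=> /proj_idealP /carrierP.
by move=> /carrierP /proj_idealP.
Qed.

Lemma ideal_hom_op_exists I J (f : ideal_hom I J) :
  exists T : finrank_op H, forall A, elt_val (f A) = elt_val A ** T.
Proof. by have [P [T [Q [_ _ _ fE]]]] := ideal_homP f; exists T. Qed.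

Section CarrierMap.
Variables (I J : principal_ideal H) (f : ideal_hom I J).

Let T := sval (cid (ideal_hom_op_exists f)).

Let TE A : elt_val (f A) = elt_val A ** T.
Proof. exact: (svalP (cid (ideal_hom_op_exists f))). Qed.

Let TIJ x : subspace_set (carrier I) x -> subspace_set (carrier J) (T x).
Proof.
move=> [A [y [IA <-]]]; exists (elt_val (f (to_elt IA))), y.
by split; [exact: elt_in|rewrite TE].
Qed.

(* T is not unique, but its restriction to carrier I is, by carrier_mapE. *)
Definition carrier_map : {linear elt (carrier I) -> elt (carrier J)} :=
  restrict (finrank_linear T) TIJ.

Lemma carrier_mapE (A : elt I) x (y : elt (carrier I)) :
  elt_val y = elt_val A x -> elt_val (carrier_map y) = elt_val (f A) x.
Proof. by move=> yA; rewrite restrictE yA TE. Qed.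

End CarrierMap.

(** Ensures that [carrier_mapE] applies at every point and so determines [carrier_map]
    completely. *)
Lemma carrier_elt I (y : elt (carrier I)) :
  exists (A : elt I) x, elt_val y = elt_val A x.
Proof. by have [A [x [IA <-]]] := elt_in y; exists (to_elt IA), x. Qed.

Lemma carrier_map_id I : carrier_map (ideal_id I) = idfun.
Proof.
apply: linear_map_ext => y; apply: elt_inj.
by have [A [x yE]] := carrier_elt y; rewrite (carrier_mapE _ yE) yE.
Qed.

Lemma carrier_map_comp I J L (f : ideal_hom I J) (g : ideal_hom J L) :
  carrier_map (ideal_comp f g) = carrier_map g \o carrier_map f.
Proof.
apply: linear_map_ext => y; apply: elt_inj.
have [A [x yE]] := carrier_elt y.
by rewrite (carrier_mapE _ yE); exact/esym/(carrier_mapE g (carrier_mapE f yE)).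
Qed.

Section IdealMap.
Variables (I J : principal_ideal H) (M N : fin_subspace H).
Hypothesis JN : forall A, subspace_set J A <-> forall x, subspace_set N (A x).
Variable g : {linear elt M -> elt N}.

Lemma ideal_map_subproof (A : elt I) :
  subspace_set J (elt_val A ** extension g).
Proof. by apply/JN => x; exact: extension_in. Qed.

Lemma ideal_map_is_rho :
  (fun A : elt I => to_elt (ideal_map_subproof A)) \in @ideal_hom_pred R k H I J.
Proof.
have [P IP] := ideal_generated I; have [Q JQ] := ideal_generated J.
case: (IP) => PP IE; case: (JQ) => QQ JE.
(* The factor [P] brings the operator into the corner and does not affect its action on [I], where
   [A ** P = A]. The factor [Q] is absorbed because the values lie in [N], so the product belongs to
   [J]. *)
apply/asboolP; exists P, (P ** extension g), Q; split=> //.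
  exists (extension g) => //.
  apply/(left_idealP _ QQ); rewrite -JE; apply/JN => x.
  exact: extension_in.
move=> A; have := elt_in A; rewrite IE => /(left_idealP _ PP) AP.
by rewrite op_mulA AP.
Qed.

(** The condition [JN] is met both by [carrierP] and by [proj_idealP], so one construction serves
    the surjectivity of [carrier_map] and the inverse functor. *)
Definition ideal_map : ideal_hom I J := IdealHom ideal_map_is_rho.

Lemma ideal_mapE (A : elt I) x (y : elt M) :
  elt_val y = elt_val A x -> elt_val (ideal_map A) x = elt_val (g y).
Proof. by move=> yA; rewrite -extensionE yA. Qed.

End IdealMap.

(** The value of [f A] at [x] is that of [carrier_map f] at the point [A x]. *)
Lemma carrier_map_inj I J (f g : ideal_hom I J) :
  carrier_map f = carrier_map g -> f = g.
Proof.
move=> fg; apply: ideal_hom_ext => A; apply: finrank_ext => x.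
have IAx := (carrierP I (elt_val A)).1 (elt_in A) x.
have yA : elt_val (to_elt IAx) = elt_val A x by [].
by rewrite -(carrier_mapE f yA) fg (carrier_mapE g yA).
Qed.

Lemma carrier_map_surj I J (g : {linear elt (carrier I) -> elt (carrier J)}) :
  exists f : ideal_hom I J, carrier_map f = g.
Proof.
exists (ideal_map I (@carrierP J) g).
apply: linear_map_ext => y; apply: elt_inj.
have [A [x yE]] := carrier_elt y.
by rewrite (carrier_mapE _ yE) (ideal_mapE _ _ yE).
Qed.

End Carrier.

(** * Normality of the category of finite-dimensional subspaces *)

Section SubspaceCategory.
Variables (R : realType) (k : scalar_kind) (H : hilbertType R k).
Local Notation C := (subspace_category H).

(** A right inverse is chosen pointwise; injectivity of [u] makes it linear and two-sided. *)
Lemma linear_bijection_iso (M N : fin_subspace H) (u : {linear elt M -> elt N}) :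
  (forall x, u x = 0 -> x = 0) -> (forall y, exists x, u x = y) ->
  @iso C M N u.
Proof.
move=> u0 /boolp.choice [v uv].
have uinj x y : u x = u y -> x = y.
  by move=> uxy; apply/eqP; rewrite -subr_eq0; apply/eqP/u0; rewrite linearB uxy subrr.
have vl : linear v by move=> a x y; apply: uinj; rewrite linearP !uv.
pose w : {linear elt N -> elt M} :=
  HB.pack v (GRing.isLinear.Build _ _ _ _ v vl).
exists w; split; apply: linear_map_ext => x /=; last exact: uv.
by apply: uinj; rewrite uv.
Qed.

Lemma restrict_inclusion (M N : fin_subspace H) :
  (M : set H) `<=` N -> exists j : @hom C M N, inclusion j.
Proof.
move=> MN; have idl : linear (@idfun H) by [].
by exists (restrict idl MN).
Qed.

Lemma subspace_has_subobjects : has_subobjects C.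
Proof.
split=> //.
- by move=> M N L f g /= fE gE x; rewrite gE fE.
- by move=> M N f g fE gE; apply: linear_map_ext => x; apply: elt_inj; rewrite fE gE.
- move=> M N f g fE gE; apply: fin_subspace_inj; apply/seteqP; split=> x Lx.
    by have := fE (to_elt Lx) => /= <-; exact: elt_in.
  by have := gE (to_elt Lx) => /= <-; exact: elt_in.
- move=> M N j jE L g h gh; apply: linear_map_ext => x; apply: elt_inj.
  have /= := congr1 (fun f : subspace_hom L N => elt_val (f x)) gh.
  by rewrite !jE.
- by move=> M N L f h g fE gE fhg x; rewrite -gE -fE fhg.
Qed.

(* f factors through the orthogonal complement Q of its kernel L in M, and its
   range J. *)
Lemma subspace_normal_factorization (M N : C) (f : hom M N) :
  has_normal_factorization f.
Proof.
pose g : {linear elt M -> elt N} := f.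
pose kerf : set H := [set x | exists x' : elt M, elt_val x' = x /\ g x' = 0].
have kerM : kerf `<=` (M : fin_subspace H) by move=> _ [x [<- _]]; exact: elt_in.
have [|L LE] := fin_subspace_of_sub _ kerM.
  split; first by exists 0; rewrite linear0.
  move=> a _ _ [x [<- gx]] [y [<- gy]]; exists (a *: x + y).
  by rewrite linearP gx gy scaler0 addr0.
(* [P_L x = 0] says that [x] is orthogonal to [L], so this is the complement of the kernel in
   [M]. *)
pose coker : set H := [set x | subspace_set (M : fin_subspace H) x /\ orth_proj L x = 0].
have cokerM : coker `<=` (M : fin_subspace H) by move=> x [].
have [|Q QE] := fin_subspace_of_sub _ cokerM.
  have [M0 Ml] := subspaceP (M : fin_subspace H); have Pl := finrank_linear (orth_proj L).
  split; first by split=> //; exact: linear_fun0.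
  by move=> a x y [Mx Px] [My Py]; split; [exact: Ml|rewrite Pl Px Py scaler0 addr0].
pose im : set H := [set y | exists x, elt_val (g x) = y].
have imN : im `<=` (N : fin_subspace H) by move=> _ [x <-]; exact: elt_in.
have [|J JE] := fin_subspace_of_sub _ imN.
  split; first by exists 0; rewrite linear0.
  by move=> a _ _ [x <-] [y <-]; exists (a *: x + y); rewrite linearP.
have LM x : subspace_set L x -> subspace_set (M : fin_subspace H) x.
  by rewrite LE; exact: kerM.
have QM x : subspace_set Q x -> subspace_set (M : fin_subspace H) x.
  by rewrite QE; exact: cokerM.
have JN x : subspace_set J x -> subspace_set (N : fin_subspace H) x.
  by rewrite JE; exact: imN.
pose P := orth_proj L.
have Tl : linear (fun x => x - P x).
  by move=> a x y; rewrite finrank_linear scalerBr opprD addrACA.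
(* The retraction onto [Q] is [1 - P_L]: it keeps [M] stable because [L] lies in [M], and [P_L]
   annihilates its values by idempotency. *)
have TMQ x : subspace_set (M : fin_subspace H) x -> subspace_set Q (x - P x).
  move=> Mx; rewrite QE; split.
    rewrite addrC -scaleN1r; apply: (proj2 (subspaceP (M : fin_subspace H))) => //.
    exact/LM/orth_proj_in.
  rewrite addrC -scaleN1r finrank_linear (orth_proj_id (orth_proj_in L x)).
  by rewrite scaleN1r addNr.
have [i iE] := restrict_inclusion QM; have [j jE] := restrict_inclusion JN.
pose q : {linear elt M -> elt Q} := restrict Tl TMQ.
pose gi : {linear elt Q -> elt N} := g \o (i : {linear elt Q -> elt M}).
have giJ x : subspace_set J (extension gi x).
  by rewrite JE /=; eexists; reflexivity.
(* The middle factor is [g] on [Q] with codomain cut down to its image; [restrict] acts on maps of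
   [H], hence the passage through [extension]. *)
pose u : {linear elt Q -> elt J} :=
  restrict (finrank_linear (extension gi)) (fun x _ => giJ x).
have uE x : elt_val (u x) = elt_val (gi x) by rewrite restrictE extensionE.
(* [x] and [q x] differ by [P_L x], which lies in the kernel of [g]. *)
have gq x : g x = gi (q x).
  have Lx : subspace_set L (P (elt_val x)) by exact: orth_proj_in.
  have := Lx; rewrite {1}LE => -[x' [x'E gx']].
  rewrite -[g x]subr0 -gx' -linearB; congr (g _); apply: elt_inj.
  by rewrite iE /= x'E.
exists Q, J, q, u, j; split=> //.
- exists i; split=> //; apply: linear_map_ext => x; apply: elt_inj => /=.
  have := elt_in x; rewrite QE => -[_ Px].
  by rewrite iE /P Px subr0.
- apply: linear_bijection_iso => [x ux|y].
    apply: elt_inj => /=.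
    have gix : gi x = 0 by apply: elt_inj; rewrite -uE ux.
    have Lx : subspace_set L (elt_val x).
      by rewrite LE; exists (i x); split; [exact: iE|exact: gix].
    have := elt_in x; rewrite QE => -[_] Px.
    by rewrite -Px orth_proj_id.
  have := elt_in y; rewrite {1}JE => -[x xE]; exists (q x).
  by apply: elt_inj; rewrite uE -gq.
- apply: linear_map_ext => x; apply: elt_inj => /=.
  by rewrite jE; have := uE (q x); rewrite /= => ->; have := gq x => /= ->.
Qed.

(** Restrictions of the single operator [P_N] to all subspaces form a cone with vertex [N], equal to
    the identity at [N]. The same maps split the inclusions. *)
Lemma subspace_category_normal : is_normal_category C.
Proof.
have pr (M N : fin_subspace H) x : subspace_set M x -> subspace_set N (orth_proj N x).
  by move=> _; exact: orth_proj_in.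
pose gamma (N M : fin_subspace H) : {linear elt M -> elt N} :=
    restrict (finrank_linear (orth_proj N)) (pr M N).
split; first exact: subspace_has_subobjects.
- exact: subspace_normal_factorization.
- move=> M N j jE; exists (gamma M N); apply: linear_map_ext => x; apply: elt_inj => /=.
  by rewrite jE orth_proj_id //; exact: elt_in.
- move=> N.
  have gN : gamma N N = idfun.
    apply: linear_map_ext => x; apply: elt_inj => /=.
    by rewrite orth_proj_id //; exact: elt_in.
  exists (gamma N); split=> //; split.
    move=> M' M j jE; apply: linear_map_ext => x; apply: elt_inj => /=.
    by rewrite jE.
  by exists N; rewrite gN; exists (idm N); split; exact: linear_map_ext.
Qed.

End SubspaceCategory.

(** * The two mutually inverse functors *)

Section Isomorphism.
Variables (R : realType) (k : scalar_kind) (H : hilbertType R k).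

(** Transport changes the types of ideals but not the underlying operators, so arguments and values
    are compared through [elt_val]. [subspace_hom_castE] does the same for vectors. *)
Lemma ideal_hom_castE (I I' J J' : principal_ideal H) (eI : I = I') (eJ : J = J')
    (f : ideal_hom I J) (A : elt I) (A' : elt I') :
  elt_val A = elt_val A' ->
  elt_val ((@hom_cast (ideal_category H) _ _ _ _ eI eJ f : ideal_hom I' J') A') =
  elt_val (f A).
Proof. by case: I' / eI A' => A'; case: J' / eJ => /elt_inj ->. Qed.

Lemma subspace_hom_castE (M M' N N' : fin_subspace H) (eM : M = M') (eN : N = N')
    (f : {linear elt M -> elt N}) (x : elt M) (x' : elt M') :
  elt_val x = elt_val x' ->
  elt_val ((@hom_cast (subspace_category H) _ _ _ _ eM eN f
    : {linear elt M' -> elt N'}) x') = elt_val (f x).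
Proof. by case: M' / eM x' => x'; case: N' / eN => /elt_inj ->. Qed.

Definition carrier_functor : functor (ideal_category H) (subspace_category H) :=
  @Functor (ideal_category H) (subspace_category H) (@carrier R k H)
    (@carrier_map R k H) (@carrier_map_id R k H) (@carrier_map_comp R k H).

Definition proj_ideal_map (M N : fin_subspace H) (g : {linear elt M -> elt N}) :
    ideal_hom (proj_ideal M) (proj_ideal N) :=
  ideal_map (proj_ideal M) (@proj_idealP R k H N) g.

Lemma proj_ideal_elt (M : fin_subspace H) (A : elt (proj_ideal M)) x :
  subspace_set M (elt_val A x).
Proof. by move: x; apply/proj_idealP; exact: elt_in. Qed.

Lemma proj_ideal_mapE (M N : fin_subspace H) (g : {linear elt M -> elt N}) A x :
  elt_val (proj_ideal_map g A) x = elt_val (g (to_elt (proj_ideal_elt A x))).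
Proof. exact: ideal_mapE. Qed.

Lemma proj_ideal_map_id (M : fin_subspace H) :
  proj_ideal_map (@idfun (elt M)) = ideal_id (proj_ideal M).
Proof.
by apply: ideal_hom_ext => A; apply: finrank_ext => x; rewrite proj_ideal_mapE.
Qed.

Lemma proj_ideal_map_comp (M N L : fin_subspace H) (g : {linear elt M -> elt N})
    (h : {linear elt N -> elt L}) :
  proj_ideal_map (h \o g) = ideal_comp (proj_ideal_map g) (proj_ideal_map h).
Proof.
apply: ideal_hom_ext => A; apply: finrank_ext => x.
rewrite proj_ideal_mapE [RHS]proj_ideal_mapE /=; congr (elt_val (h _)).
by apply: elt_inj; rewrite [RHS]proj_ideal_mapE.
Qed.

Definition proj_ideal_functor : functor (subspace_category H) (ideal_category H) :=
  @Functor (subspace_category H) (ideal_category H) (@proj_ideal R k H)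
    proj_ideal_map proj_ideal_map_id proj_ideal_map_comp.

Lemma carrier_functor_inclusion (I J : ideal_category H) (f : hom I J) :
  inclusion f <-> inclusion (fmap carrier_functor f).
Proof.
split=> [fE y|fE A].
  have [A [x yE]] := carrier_elt y.
  apply: etrans (carrier_mapE (f : ideal_hom I J) yE) _.
  by rewrite yE (fE A : elt_val _ = _).
apply: finrank_ext => x.
have IAx := (carrierP I (elt_val A)).1 (elt_in A) x.
rewrite -(carrier_mapE (f : ideal_hom I J) (y := to_elt IAx) erefl).
exact: fE.
Qed.

Lemma proj_ideal_functor_inclusion : inclusion_preserving proj_ideal_functor.
Proof.
move=> M N g gE A; apply: finrank_ext => x.
by rewrite -[LHS]/(elt_val (proj_ideal_map g A) x) proj_ideal_mapE gE.
Qed.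

Lemma carrier_functorK :
  functor_comp carrier_functor proj_ideal_functor = functor_id (ideal_category H).
Proof.
apply: (@functor_eq _ _ (functor_comp carrier_functor proj_ideal_functor)
  (functor_id _) (@proj_ideal_carrier R k H)) => I J f.
apply: ideal_hom_ext => A.
(* [A] is viewed as an element of the ideal rebuilt from the carrier, so that the transported
   morphism can be evaluated. *)
have IA : subspace_set (proj_ideal (carrier I)) (elt_val A).
  by rewrite proj_ideal_carrier; exact: elt_in.
rewrite (ideal_hom_castE _ _ _ (A := to_elt IA)) //; apply: finrank_ext => x.
by rewrite proj_ideal_mapE (carrier_mapE (f : ideal_hom I J) (A := A) (x := x)).
Qed.

Lemma proj_ideal_functorK :
  functor_comp proj_ideal_functor carrier_functor = functor_id (subspace_category H).
Proof.
apply: (@functor_eq _ _ (functor_comp proj_ideal_functor carrier_functor)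
  (functor_id _) (@carrier_proj_ideal R k H)) => M N g.
apply: linear_map_ext => y; apply: elt_inj.
have My : subspace_set (carrier (proj_ideal M)) (elt_val y).
  by rewrite carrier_proj_ideal; exact: elt_in.
rewrite (subspace_hom_castE _ _ _ (x := to_elt My)) //.
have [A [x yE]] := carrier_elt (to_elt My).
rewrite (carrier_mapE _ yE) proj_ideal_mapE; congr (elt_val (g _)).
by apply: elt_inj; rewrite /= -yE.
Qed.

Definition carrier_isomorphism :
    normal_isomorphism (ideal_category H) (subspace_category H) :=
  NormalIsomorphism (fun I J f => proj1 (@carrier_functor_inclusion I J f))
    proj_ideal_functor_inclusion carrier_functorK proj_ideal_functorK.

Lemma ideal_category_normal : is_normal_category (ideal_category H).
Proof.
apply: (normal_category_reflect (F := carrier_functor)).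
- by move=> I J /= IJ; rewrite -(proj_ideal_carrier I) IJ proj_ideal_carrier.
- by move=> M; exists (proj_ideal M); exact: carrier_proj_ideal.
- exact: carrier_map_inj.
- exact: carrier_map_surj.
- exact: carrier_functor_inclusion.
- exact: subspace_category_normal.
Qed.

(** * Linearity, bijectivity and norm preservation on hom-sets *)

Section HomRestriction.
Variables M N : fin_subspace H.
Local Notation phi :=
  (@hom_restriction R k H carrier_isomorphism (@carrier_proj_ideal R k H) M N).

Lemma hom_restrictionE (f : ideal_hom (proj_ideal M) (proj_ideal N))
    (A : elt (proj_ideal M)) x (y : elt M) :
  elt_val y = elt_val A x -> elt_val (phi f y) = elt_val (f A) x.
Proof.
move=> yA; have My : subspace_set (carrier (proj_ideal M)) (elt_val y).
  by rewrite carrier_proj_ideal; exact: elt_in.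
rewrite (subspace_hom_castE _ _ _ (x := to_elt My)) //.
exact: carrier_mapE.
Qed.

(** [P_M] lies in its own ideal and takes the value [y] at [y]; this is the counterpart of
    [carrier_elt] after transport to [M]. *)
Lemma proj_elt (y : elt M) :
  exists (A : elt (proj_ideal M)) x, elt_val y = elt_val A x.
Proof.
have PM : subspace_set (proj_ideal M) (orth_proj M).
  by apply/proj_idealP => x; exact: orth_proj_in.
by exists (to_elt PM), (elt_val y); rewrite /= orth_proj_id //; exact: elt_in.
Qed.

Lemma hom_restriction_linear : linear phi.
Proof.
move=> a f g; apply: linear_map_ext => y; apply: elt_inj.
have [A [x yE]] := proj_elt y.
by rewrite elt_valD !(hom_restrictionE _ yE).
Qed.

Lemma hom_restriction_bijective : bijective phi.
Proof.
exists (@proj_ideal_map M N) => [f|g].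
  apply: ideal_hom_ext => A; apply: finrank_ext => x.
  by rewrite proj_ideal_mapE (hom_restrictionE f (A := A) (x := x)).
apply: linear_map_ext => y; apply: elt_inj.
have [A [x yE]] := proj_elt y.
rewrite (hom_restrictionE _ yE) proj_ideal_mapE; congr (elt_val (g _)).
exact: elt_inj.
Qed.

(** Norms of vectors take values in the scalar field, whose order over the complex numbers compares
    real parts; the operator norm is a supremum of reals. *)
Lemma scalar_re_le (a b : scalar_field R k) : a <= b -> scalar_re a <= scalar_re b.
Proof. by case: (k) a b => //= a b; rewrite lecE => /andP []. Qed.

Lemma hom_restriction_norm (f : ideal_hom (proj_ideal M) (proj_ideal N)) :
  subspace_hom_norm (phi f) = ideal_hom_norm f.
Proof.
have [T [PTQ fE]] := ideal_hom_rho f.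
rewrite {2}fE /ideal_hom_norm ideal_hom_op_rho.
(* [T] lies in the corner, so its left factor [P_M] can be repeated. *)
have PT x : T x = T (orth_proj M x).
  by have [S _ <-] := PTQ; rewrite /= (orth_proj_id (orth_proj_in M x)).
have phiE y : elt_val (phi f y) = T (elt_val y).
  by have [A [x yE]] := proj_elt y; rewrite (hom_restrictionE _ yE) fE /= yE.
rewrite /subspace_hom_norm /op_norm /operator_norm; congr (sup _).
apply/seteqP; split=> _ [x x1 <-].
  by exists (elt_val x) => //; rewrite phiE.
(* A point of the unit ball of [H] is replaced by its projection, which lies in the unit ball of [M]
   and has the same image under [T]. *)
exists (to_elt (orth_proj_in M x)); last by rewrite phiE [in RHS]PT.
by apply: le_trans x1; exact/scalar_re_le/orth_proj_norm_le.
Qed.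

End HomRestriction.
End Isomorphism.

Theorem theorem4p1 (R : realType) (k : scalar_kind) (H : hilbertType R k) :
  is_normal_category (ideal_category H) /\
  is_normal_category (subspace_category H) /\
  exists (F : normal_isomorphism (ideal_category H) (subspace_category H))
         (eF : forall M : fin_subspace H, F (proj_ideal M) = M),
    forall M N : fin_subspace H,
      normed_space_isomorphism (@ideal_hom_norm R k H M N)
        (@subspace_hom_norm R k H M N) (@hom_restriction R k H F eF M N).
Proof.
split; first exact: ideal_category_normal.
split; first exact: subspace_category_normal.
exists (carrier_isomorphism H), (@carrier_proj_ideal R k H) => M N; split.
- exact: hom_restriction_linear.
- exact: hom_restriction_bijective.
- exact: hom_restriction_norm.
Qed.
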